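(* For every integer $n\ge 0$, the visibility polynomial of the star graph $S_n$ of order $n+1$ is $\mathcal{V}(S_n)=x+nx^2+(1+x)^n$.
   Context: Graphs are finite, simple and undirected. For a graph $G=(V,E)$ and $X\subseteq V$, two vertices $u,v$ are $X$-visible if there is a shortest $(u,v)$-path $P$ in $G$ with $V(P)\cap X\subseteq\{u,v\}$. A set $X\subseteq V$ is a mutual-visibility set of $G$ if every pair of vertices in $X$ is $X$-visible (the empty set counts as a mutual-visibility set). The visibility polynomial of $G$ is $\mathcal{V}(G)=\sum_{i\ge 0} r_i x^i$, where $r_i$ is the number of mutual-visibility sets of $G$ of cardinality $i$. The star $S_n$ has $n+1$ vertices $v_1,\dots,v_n,v_{n+1}$ and its edges are exactly $v_{n+1}v_i$ for $1\le i\le n$. *)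

(* Defs.v *)
From HB Require Import structures.
From mathcomp Require Import all_boot all_order all_algebra.
From mathcomp Require Import boolp.

Set Implicit Arguments.
Unset Strict Implicit.
Unset Printing Implicit Defensive.

Import GRing.Theory.
Local Open Scope ring_scope.

Record sgraph := SGraph {
  vertex :> finType;
  adj : rel vertex;
  adj_sym : symmetric adj;
  adj_irrefl : irreflexive adj
}.

Section Visibility.
Variable G : sgraph.
Implicit Types (u v : G) (p : seq G) (X : {set G}).

(* The vertex sequence of the path is u :: p, so its length is size p. *)
Definition is_path u v p : Prop :=
  [/\ path (@adj G) u p, last u p = v & uniq (u :: p)].

Definition is_shortest_path u v p : Prop :=
  is_path u v p /\ forall q, is_path u v q -> (size p <= size q)%N.

Definition visible X u v : Prop :=
  exists2 p, is_shortest_path u v p &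
    forall w, w \in u :: p -> w \in X -> w \in [:: u; v].

Definition mutual_visibility X : Prop :=
  forall u v, u \in X -> v \in X -> visible X u v.

Definition num_mutual_visibility (i : nat) : nat :=
  #|[set X : {set G} | `[< mutual_visibility X >] & #|X| == i]|.

(* No set of vertices has more than #|G| elements, so truncating the formal
   sum over i >= 0 at degree #|G| loses no term. *)
Definition visibility_poly : {poly int} :=
  \poly_(i < #|G|.+1) (num_mutual_visibility i)%:R.

End Visibility.

(* The vertex v_k, 1 <= k <= n+1, is the ordinal k-1; the centre v_{n+1} is
   ord_max. *)
Definition star_adj (n : nat) : rel 'I_n.+1 :=
  fun a b => ((a == ord_max) && (b != ord_max))
          || ((a != ord_max) && (b == ord_max)).

Lemma star_adj_sym n : symmetric (@star_adj n).
Proof. by move=> a b; rewrite /star_adj orbC andbC [X in _ || X]andbC. Qed.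

Lemma star_adj_irrefl n : irreflexive (@star_adj n).
Proof. by move=> a; rewrite /star_adj; case: (a == ord_max). Qed.

Definition star (n : nat) : sgraph :=
  SGraph (@star_adj_sym n) (@star_adj_irrefl n).

(* Main.v *)
Require Import Defs.
From HB Require Import structures.
From mathcomp Require Import all_boot all_order all_algebra.
From mathcomp Require Import boolp.

(** Two leaves of a star are joined by a unique path, which runs through the
    centre [c]. Hence a set avoiding [c] is always a mutual-visibility set,
    while a set containing [c] is one exactly when it does not contain two
    leaves, that is, when it has at most two elements
    ([mutual_visibility_star]).

    The visibility polynomial is the generating function, by cardinality, of the
    mutual-visibility sets ([visibility_polyE]), so it splits accordingly. The
    sets of leaves contribute (1 + x)^n, by the binomial theorem
    ([sum_subset_expr]). The sets of at most two elements containing [c] are the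
    [[set c; v]] with [v] any vertex: [v = c] contributes x, and each of the
    [n] leaves contributes x^2. *)

Set Implicit Arguments.
Unset Strict Implicit.
Unset Printing Implicit Defensive.

Import GRing.Theory.
Local Open Scope ring_scope.

Lemma visibility_polyE (G : sgraph) :
  visibility_poly G = \sum_(X : {set G} | `[< mutual_visibility X >]) 'X^#|X|.
Proof.
rewrite /visibility_poly poly_def.
rewrite (partition_big (fun X : {set G} => inord #|X| : 'I_#|G|.+1) xpredT) //=.
apply: eq_bigr => i _.
rewrite (eq_bigl [in [set X : {set G} | `[< mutual_visibility X >]
                                      & #|X| == i]]); last first.
  by move=> X; rewrite inE -val_eqE /= inordK // ltnS max_card.
rewrite (eq_bigr (fun=> 'X^i)) => [|X]; last by rewrite inE => /andP[_ /eqP->].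
by rewrite sumr_const scaler_nat.
Qed.

Lemma sum_subset_expr (R : comNzRingType) (T : finType) (A : {set T}) (x : R) :
  \sum_(B : {set T} | B \subset A) x ^+ #|B| = (1 + x) ^+ #|A|.
Proof.
rewrite exprDn.
rewrite (partition_big (fun B : {set T} => inord #|B| : 'I_#|A|.+1) xpredT) //=.
apply: eq_bigr => i _.
rewrite (eq_bigl [in [set B : {set T} | B \subset A & #|B| == i]]); last first.
  move=> B; rewrite inE; case: (boolP (B \subset A)) => //= sBA.
  by rewrite -val_eqE /= inordK // ltnS subset_leq_card.
rewrite (eq_bigr (fun=> x ^+ i)) => [|B]; last by rewrite inE => /andP[_ /eqP->].
by rewrite sumr_const cards_draws expr1n mul1r.
Qed.

(** A set of at most two elements containing [c] is some [[set c; v]], with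
    [v = c] for the singleton; this indexing by [v] is bijective. *)
Lemma sum_card_le2_expr (R : comNzRingType) (T : finType) (c : T) (x : R) :
  \sum_(B : {set T} | (c \in B) && (#|B| <= 2)%N) x ^+ #|B|
  = x + (x ^+ 2) *+ #|T|.-1.
Proof.
have pair_inj : {in predT &, injective (fun v : T => [set c; v])}.
  move=> v w _ _ /setP eq_vw; have := eq_vw v; have := eq_vw w.
  rewrite !inE !eqxx !orbT (eq_sym w v).
  by case: (eqVneq v w) => //= _; rewrite !orbF => /eqP-> /esym/eqP->.
rewrite (eq_bigl [in [set [set c; v] | v in predT]]); last first.
  move=> B; apply/andP/imsetP => [[cB leB2]|[v _ ->]]; last first.
    by rewrite !inE eqxx cards2; case: (c != v).
  have leB1 : (#|B :\ c| <= 1)%N by rewrite (cardsD1 c B) cB in leB2.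
  have [B0|[v vB]] := set_0Vmem (B :\ c).
    by exists c; rewrite // setUid -(setD1K cB) B0 setU0.
  exists v; rewrite // -(setD1K cB); congr (_ |: _); apply/esym/eqP.
  by rewrite eqEcard sub1set vB cards1.
rewrite big_imset //= (bigD1 c) //= setUid cards1 expr1; congr (_ + _).
rewrite (eq_bigr (fun=> x ^+ 2)) => [|v]; last first.
  by rewrite eq_sym cards2 => ->.
rewrite sumr_const; congr (_ *+ _).
by rewrite -(cardC1 c); apply: eq_card => v; rewrite !inE.
Qed.

Section ShortVisibility.
Variable G : sgraph.
Implicit Types (u v w : G) (X : {set G}).

Lemma visible_refl X u : visible X u u.
Proof. by exists [::] => [|w]; [split | rewrite !inE => ->]. Qed.

Lemma visible_adj X u v : adj u v -> visible X u v.
Proof.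
move=> uv; have neq_uv : u != v.
  by apply: contraTneq uv => ->; rewrite adj_irrefl.
exists [:: v] => [|w //]; split; first by split; rewrite //= ?uv ?inE ?neq_uv.
by case=> [[_ /= eq_uv _]|//]; rewrite eq_uv eqxx in neq_uv.
Qed.

(** Distinct non-adjacent vertices are at distance at least two, so a path
    through a common neighbour is a shortest one. *)
Lemma visible_common_neighbor X u v w :
    u != v -> ~~ adj u v -> adj u w -> adj w v -> w \notin X ->
  visible X u v.
Proof.
move=> neq_uv nadj_uv uw wv wX.
exists [:: w; v] => [|z]; last first.
  by rewrite !inE => /or3P[/eqP->|/eqP->|/eqP->]; rewrite ?eqxx ?orbT ?(negPf wX).
split.
  split; rewrite //= ?uw ?wv // !inE !negb_or neq_uv !andbT.
  by apply/andP; split; [apply: contraTneq uw|apply: contraTneq wv] => ->;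
     rewrite adj_irrefl.
case=> [[_ /= eq_uv _]|a [[/andP[ua _] /= eq_av _]|//]].
  by rewrite eq_uv eqxx in neq_uv.
by rewrite -eq_av ua in nadj_uv.
Qed.

End ShortVisibility.

Lemma mutual_visibility_star n (X : {set star n}) :
  mutual_visibility X <-> (ord_max : star n) \notin X \/ (#|X| <= 2)%N.
Proof.
pose c : star n := ord_max.
split=> [visX|smallX u v uX vX].
  case: (boolP (c \in X)) => cX; [right | by left].
  rewrite leqNgt; apply/negP => gtX2.
  have /card_gt1P[u [v [uX vX neq_uv]]] : (1 < #|X :\ c|)%N.
    by rewrite (cardsD1 c X) cX in gtX2.
  move: uX vX; rewrite !inE => /andP[u_c uX] /andP[v_c vX].
  have [p [[path_p last_p _] _] Xp] := visX u v uX vX.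
  (* The second vertex of a path that leaves the leaf [u] is the centre. *)
  have c_p : c \in u :: p.
    case: p path_p last_p {Xp} => [_ eq_uv|a p /= /andP[ua _] _].
      by rewrite -eq_uv eqxx in neq_uv.
    move: ua; rewrite /star_adj (negPf u_c) /= => /eqP->.
    by rewrite !inE eqxx orbT.
  by have := Xp c c_p cX; rewrite !inE eq_sym (negPf u_c) eq_sym (negPf v_c).
have [->|neq_uv] := eqVneq u v; first exact: visible_refl.
have [uv|nadj_uv] := boolP (adj u v); first exact: visible_adj.
have [u_c v_c] : u != c /\ v != c.
  split; apply: contraNneq nadj_uv => eq_c; move: neq_uv;
    rewrite /= /star_adj -/c eq_c eqxx; first by rewrite eq_sym => ->.
  by move=> ->; rewrite orbT.
apply: (@visible_common_neighbor _ _ _ _ c) => //.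
- by rewrite /= /star_adj u_c eqxx orbT.
- by rewrite /= /star_adj v_c eqxx.
(* If the centre were in [X], then [X] would contain three vertices. *)
case: smallX => // leX2; apply: contraL leX2 => cX; rewrite -ltnNge.
by apply/card_gt2P; exists u, v, c; split; split; rewrite // eq_sym.
Qed.

Theorem theorem5 (n : nat) :
  visibility_poly (star n) = 'X + n%:R *: 'X^2 + (1 + 'X) ^+ n.
Proof.
pose c : star n := ord_max.
have card_star : #|star n| = n.+1 by rewrite card_ord.
rewrite visibility_polyE (bigID (fun X : {set star n} => c \in X)) /=.
congr (_ + _).
  rewrite (eq_bigl (fun X : {set star n} => (c \in X) && (#|X| <= 2)%N)).
    by rewrite sum_card_le2_expr card_star scaler_nat.
  move=> X; rewrite andbC; case: (boolP (c \in X)) => //= cX.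
  apply/asboolP/idP => [/mutual_visibility_star[|//]|leX2]; first by rewrite cX.
  by apply/mutual_visibility_star; right.
have card_leaves : #|~: [set c]| = n by rewrite cardsC1 card_star.
rewrite -[in RHS]card_leaves -sum_subset_expr; apply: eq_bigl => X.
rewrite subsetC sub1set inE; case: (boolP (c \in X)) => cX /=.
  by rewrite andbF.
by rewrite andbT; apply/asboolP/mutual_visibility_star; left.
Qed.
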